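(* Let $b_0,b_1,\ldots,b_{k-1}$ be a sequence of non-negative integers of length $k\ge 1$, let $l=b_{k-1}$, and let $s_n=ql+b_j$, where $n=qk+j$ with $0\le j\le k-1$. Let $(\ell_n)_{n\ge0}$ be a sequence satisfying the Appell relation $$\sum_{n=0}^{\infty}\ell_n t^n\phi(t)^{s_n}=\Psi(t),$$ where $\phi(t)$ and $\Psi(t)$ are algebraic (power series) and $\phi(0)=1$. Then the ordinary generating function $\sum_{n=0}^{\infty}\ell_n z^n$ and the section generating functions $\sum_{q=0}^{\infty}\ell_{qk+j}z^q$, $0\le j\le k-1$, are algebraic.
   Context: All series are formal power series with complex coefficients, and the $\ell_n$ are complex numbers; the Appell relation is an identity of formal power series in $t$. A formal power series in $t$ (respectively $z$) is algebraic if it is algebraic over the field $\mathbb{C}(t)$ (respectively $\mathbb{C}(z)$) of rational functions. *)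

(* Defs.v *)
From HB Require Import structures.
From mathcomp Require Import all_boot all_order all_algebra.
From mathcomp Require Import boolp zify.

Set Implicit Arguments.
Unset Strict Implicit.
Unset Printing Implicit Defensive.

Import GRing.Theory.
Local Open Scope ring_scope.

(* A record rather than an alias of [nat -> R], so that the ring structure is
   the Cauchy product and not the pointwise product of functions. *)
Record fps (R : Type) := Fps { fps_coef :> nat -> R }.

Lemma fpsP (R : Type) (f g : fps R) : f =1 g <-> f = g.
Proof. by split=> [|-> //]; case: f g => [f] [g] /= /funext ->. Qed.

HB.instance Definition _ (R : Type) := gen_eqMixin (fps R).
HB.instance Definition _ (R : Type) := gen_choiceMixin (fps R).

Section FpsRing.
Variable R : comNzRingType.
Implicit Types (f g h : fps R) (p q : {poly R}).

Definition fps_of_poly p : fps R := Fps (fun n => p`_n).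

Definition fps_opp f : fps R := Fps (fun n => - f n).
Definition fps_add f g : fps R := Fps (fun n => f n + g n).
Definition fps_mul f g : fps R := Fps (fun n => \sum_(i < n.+1) f i * g (n - i)%N).

Fact fps_addA : associative fps_add.
Proof. by move=> f g h; apply/fpsP => n /=; rewrite addrA. Qed.
Fact fps_addC : commutative fps_add.
Proof. by move=> f g; apply/fpsP => n /=; rewrite addrC. Qed.
Fact fps_add0 : left_id (fps_of_poly 0) fps_add.
Proof. by move=> f; apply/fpsP => n /=; rewrite coef0 add0r. Qed.
Fact fps_addN : left_inverse (fps_of_poly 0) fps_opp fps_add.
Proof. by move=> f; apply/fpsP => n /=; rewrite coef0 addNr. Qed.

HB.instance Definition _ :=
  GRing.isZmodule.Build (fps R) fps_addA fps_addC fps_add0 fps_addN.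

Definition fps_trunc n f : {poly R} := \poly_(i < n.+1) f i.

Lemma coef_fps_trunc n f i : (i <= n)%N -> (fps_trunc n f)`_i = f i.
Proof. by move=> le_in; rewrite coef_poly ltnS le_in. Qed.

Lemma fps_mul_coefM f g p q n :
  (forall i, (i <= n)%N -> f i = p`_i) -> (forall i, (i <= n)%N -> g i = q`_i) ->
  fps_mul f g n = (p * q)`_n.
Proof.
move=> fp gq; rewrite coefM /=; apply: eq_bigr => i _.
by rewrite fp ?gq ?leq_subr // -ltnS.
Qed.

Lemma fps_mul_trunc f g m n : (m <= n)%N ->
  fps_mul f g m = (fps_trunc n f * fps_trunc n g)`_m.
Proof.
by move=> mn; apply: fps_mul_coefM => i im; rewrite coef_fps_trunc ?(leq_trans im).
Qed.

Fact fps_mulA : associative fps_mul.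
Proof.
move=> f g h; apply/fpsP => n.
transitivity (fps_trunc n f * (fps_trunc n g * fps_trunc n h))`_n.
  by apply: fps_mul_coefM => i le_in; rewrite ?coef_fps_trunc ?(fps_mul_trunc _ _ le_in).
rewrite mulrA; symmetry.
by apply: fps_mul_coefM => i le_in; rewrite ?coef_fps_trunc ?(fps_mul_trunc _ _ le_in).
Qed.
Fact fps_mulC : commutative fps_mul.
Proof.
by move=> f g; apply/fpsP => n; rewrite !(@fps_mul_trunc _ _ n n) // mulrC.
Qed.
Fact fps_mul1 : left_id (fps_of_poly 1) fps_mul.
Proof.
move=> f; apply/fpsP => n.
rewrite (@fps_mul_coefM _ _ 1 (fps_trunc n f)) ?mul1r ?coef_fps_trunc //.
by move=> i le_in; rewrite coef_fps_trunc.
Qed.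
Fact fps_mulD : left_distributive fps_mul fps_add.
Proof.
move=> f g h; apply/fpsP => n /=; rewrite -big_split /=.
by apply: eq_bigr => i _; rewrite mulrDl.
Qed.
Fact fps_oner_neq0 : fps_of_poly 1 != 0.
Proof.
by apply/eqP => /fpsP/(_ 0%N)/eqP; rewrite /= coef1 coef0 oner_eq0.
Qed.

HB.instance Definition _ := GRing.Zmodule_isComNzRing.Build (fps R)
  fps_mulA fps_mulC fps_mul1 fps_mulD fps_oner_neq0.

Lemma coef_fpsD f g n : (f + g) n = f n + g n. Proof. by []. Qed.
Lemma coef_fpsN f n : (- f) n = - f n. Proof. by []. Qed.
Lemma coef_fps0 n : (0 : fps R) n = 0. Proof. exact: coef0. Qed.
Lemma coef_fpsM f g n : (f * g) n = \sum_(i < n.+1) f i * g (n - i)%N.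
Proof. by []. Qed.

Fact fps_of_poly_zmod_morphism : zmod_morphism fps_of_poly.
Proof. by move=> p q; apply/fpsP => n /=; rewrite coefB. Qed.
HB.instance Definition _ := GRing.isZmodMorphism.Build {poly R} (fps R)
  fps_of_poly fps_of_poly_zmod_morphism.

Fact fps_of_poly_monoid_morphism : monoid_morphism fps_of_poly.
Proof. by split=> // p q; apply/fpsP => n /=; rewrite coefM. Qed.
HB.instance Definition _ := GRing.isMonoidMorphism.Build {poly R} (fps R)
  fps_of_poly fps_of_poly_monoid_morphism.

Lemma fps_of_poly_eq0 p : (fps_of_poly p == 0) = (p == 0).
Proof.
apply/eqP/eqP => [/fpsP p0|->]; last exact: rmorph0.
by apply/polyP => i; rewrite coef0; move: (p0 i); rewrite coef_fps0.
Qed.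

(* Convergence of [\sum_n u n] to [f] in the t-adic (coefficientwise discrete)
   topology. *)
Definition fps_sum_to (u : nat -> fps R) f :=
  forall m, exists N0, forall N, (N0 <= N)%N -> (\sum_(n < N) u n) m = f m.

(* The inverse is defined by choice; it is the ring inverse on invertible series
   and the identity elsewhere. *)
Definition fps_unit : pred (fps R) := fun f => `[< exists g, g * f = 1 >].
Definition fps_inv f : fps R :=
  if pselect (exists g, g * f = 1) is left ex then projT1 (cid ex) else f.

Fact fps_mulVr : {in fps_unit, left_inverse 1 fps_inv *%R}.
Proof.
move=> f /asboolP ex; rewrite /fps_inv; case: pselect => // ex'.
exact: projT2 (cid ex').
Qed.
Fact fps_unitPl f g : g * f = 1 -> fps_unit f.
Proof. by move=> gf; apply/asboolP; exists g. Qed.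
Fact fps_inv_out : {in [predC fps_unit], fps_inv =1 id}.
Proof.
move=> f; rewrite inE /= => /asboolPn nex.
by rewrite /fps_inv; case: pselect.
Qed.

HB.instance Definition _ := GRing.ComNzRing_hasMulInverse.Build (fps R)
  fps_mulVr fps_unitPl fps_inv_out.

End FpsRing.

Section FpsIdomain.
Variable R : idomainType.

Lemma fps_neq0_order (f : fps R) : f != 0 ->
  exists n, f n != 0 /\ forall i, (i < n)%N -> f i = 0.
Proof.
move=> f0; have ex : exists n, f n != 0.
  apply: contrapT => nex; move/eqP: f0; apply; apply/fpsP => n.
  rewrite coef_fps0; apply: contrapT => fn; apply: nex; exists n; exact/eqP.
case: (ex_minnP ex) => n fn min; exists n; split=> // i lt_in.
by apply/eqP; apply: contraTT lt_in => /min; rewrite -leqNgt.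
Qed.

Fact fps_idomain (f g : fps R) : f * g = 0 -> (f == 0) || (g == 0).
Proof.
apply: contra_eqT; rewrite negb_or => /andP[].
move=> /fps_neq0_order[m [fm mlt]] /fps_neq0_order[n [gn nlt]].
apply/eqP => /fpsP/(_ (m + n)%N)/eqP; apply/negP.
have lt_m : (m < (m + n).+1)%N by rewrite ltnS leq_addr.
rewrite coef_fpsM coef_fps0 (bigD1 (Ordinal lt_m)) //= big1 ?addr0 => [|i].
  by rewrite addKn mulf_neq0.
rewrite -val_eqE /= neq_ltn => /orP[/mlt->|lt_mi]; first by rewrite mul0r.
rewrite nlt ?mulr0 // ltn_psubLR ?ltn_add2r //.
have := ltn_ord i; lia.
Qed.

HB.instance Definition _ := GRing.ComUnitRing_isIntegral.Build (fps R) fps_idomain.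

Local Notation "x %:F" := (@FracField.tofrac _ x).

Lemma fracE (A : idomainType) (x : {fraction A}) :
  x = (\n_(repr x))%:F / (\d_(repr x))%:F.
Proof.
have d0 : (\d_(repr x))%:F != 0 :> {fraction A} by rewrite tofrac_eq0 denom_ratioP.
apply: (mulIf d0); rewrite mulfVK //.
rewrite -{1}[x]reprK; unlock FracField.tofrac.
rewrite -[LHS]FracField.pi_mul; apply/eqP.
rewrite FracField.equivf_def /FracField.mulf !numden_Ratio ?mulf_neq0 ?oner_neq0 ?denom_ratioP //.
by rewrite !mulr1 mulrC.
Qed.

(* The embedding of R(t) into the field of fractions of R[[t]]. *)
Definition fps_ratfun (x : {fraction {poly R}}) : {fraction fps R} :=
  (fps_of_poly \n_(repr x))%:F / (fps_of_poly \d_(repr x))%:F.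

Lemma fps_ratfunE p q : q != 0 ->
  fps_ratfun (p%:F / q%:F) = (fps_of_poly p)%:F / (fps_of_poly q)%:F.
Proof.
move=> q0; rewrite /fps_ratfun; set x := p%:F / q%:F.
have d0 := denom_ratioP (repr x); have xE := fracE x.
have /eqP : x = p%:F / q%:F by [].
rewrite [X in X == _]xE !eqr_div ?tofrac_eq0 ?fps_of_poly_eq0 // -!tofracM !tofrac_eq.
move=> /eqP E; apply/eqP.
by rewrite eqr_div ?tofrac_eq0 ?fps_of_poly_eq0 // -!tofracM -!rmorphM E.
Qed.

Fact fps_ratfun_zmod_morphism : zmod_morphism fps_ratfun.
Proof.
move=> x y; rewrite (fracE x) (fracE y).
have := denom_ratioP (repr x); have := denom_ratioP (repr y).
move: (\n_(repr x)) (\d_(repr x)) (\n_(repr y)) (\d_(repr y)) => a b c d d0 b0.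
have nz q : q != 0 -> (fps_of_poly q)%:F != 0 by rewrite tofrac_eq0 fps_of_poly_eq0.
rewrite -mulNr addf_div ?tofrac_eq0 // -tofracN -!tofracM -tofracD.
rewrite !fps_ratfunE ?mulf_neq0 // -mulNr addf_div ?nz //.
by rewrite -tofracN -!tofracM -tofracD rmorphD !rmorphM rmorphN.
Qed.
HB.instance Definition _ := GRing.isZmodMorphism.Build
  {fraction {poly R}} {fraction fps R} fps_ratfun fps_ratfun_zmod_morphism.

Fact fps_ratfun_monoid_morphism : monoid_morphism fps_ratfun.
Proof.
split=> [|x y].
  have -> : 1 = 1%:F / 1%:F :> {fraction {poly R}} by rewrite tofrac1 divr1.
  by rewrite fps_ratfunE ?oner_eq0 ?oner_neq0 // rmorph1 divr1.
rewrite (fracE x) (fracE y).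
have := denom_ratioP (repr x); have := denom_ratioP (repr y).
move: (\n_(repr x)) (\d_(repr x)) (\n_(repr y)) (\d_(repr y)) => a b c d d0 b0.
rewrite mulf_div -!tofracM !fps_ratfunE ?mulf_neq0 //.
by rewrite mulf_div -!tofracM !rmorphM.
Qed.
HB.instance Definition _ := GRing.isMonoidMorphism.Build
  {fraction {poly R}} {fraction fps R} fps_ratfun fps_ratfun_monoid_morphism.

Definition fps_algebraic (f : fps R) : Prop := algebraicOver fps_ratfun f%:F.

End FpsIdomain.

(* Main.v *)
(* With Z = t phi(t)^(l/k), the Appell relation reads
     \sum_(j < k) t^j phi(t)^(b_j) A_j(Z^k) = Psi(t),
   where A_j is the j-th section generating function. Z is algebraic and
   invertible for composition, so after expressing t through Z and replacing Z by
   w^i Z, for w a primitive k-th root of unity, one gets k linear equations with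
   algebraic coefficients in the unknowns Z^j A_j(Z^k). Their determinant has as
   constant term a Vandermonde determinant in the k-th roots of unity, so Cramer's
   rule makes the unknowns algebraic; Z being algebraic over C(Z^k), so are the
   A_j. *)
From HB Require Import structures.
Require Import Defs.
From mathcomp Require Import all_boot all_order all_algebra all_solvable all_field.
From mathcomp Require Import ring reals complex.

Set Implicit Arguments.
Unset Strict Implicit.
Unset Printing Implicit Defensive.

Import GRing.Theory.
Local Open Scope ring_scope.

(** * Algebraic elements over an injective ring morphism *)

Section FracMap.
Variables (A B : idomainType) (h : {rmorphism A -> B}).

Local Notation "x %:F" := (@FracField.tofrac _ x).

Lemma inj_rmorph_eq0 : injective h -> forall a, (h a == 0) = (a == 0).
Proof. by move=> h_inj a; rewrite -(inj_eq h_inj) rmorph0. Qed.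

(* The value does not depend on the injectivity argument: it is there so that the
   ring morphism instance below can be inferred. *)
Definition frac_map (_ : injective h) (x : {fraction A}) : {fraction B} :=
  (h \n_(repr x))%:F / (h \d_(repr x))%:F.

Variable h_inj : injective h.

Let h_eq0 := inj_rmorph_eq0 h_inj.

Lemma frac_mapE p q : q != 0 ->
  frac_map h_inj (p%:F / q%:F) = (h p)%:F / (h q)%:F.
Proof.
move=> q0; rewrite /frac_map; set x := p%:F / q%:F.
have d0 := denom_ratioP (repr x).
have /eqP := fracE x; rewrite eqr_div ?tofrac_eq0 // -!tofracM tofrac_eq => /eqP E.
apply/eqP; rewrite eqr_div ?tofrac_eq0 ?h_eq0 // -!tofracM tofrac_eq -!rmorphM.
by rewrite E.
Qed.

Fact frac_map_zmod_morphism : zmod_morphism (frac_map h_inj).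
Proof.
move=> x y; rewrite (fracE x) (fracE y).
have := denom_ratioP (repr x); have := denom_ratioP (repr y).
move: (\n_(repr x)) (\d_(repr x)) (\n_(repr y)) (\d_(repr y)) => a b c d d0 b0.
have nz q : q != 0 -> (h q)%:F != 0 by rewrite tofrac_eq0 h_eq0.
rewrite -mulNr addf_div ?tofrac_eq0 // -tofracN -!tofracM -tofracD.
rewrite !frac_mapE ?mulf_neq0 // -mulNr addf_div ?nz //.
by rewrite -tofracN -!tofracM -tofracD rmorphD !rmorphM rmorphN.
Qed.
HB.instance Definition _ := GRing.isZmodMorphism.Build
  {fraction A} {fraction B} (frac_map h_inj) frac_map_zmod_morphism.

Lemma frac_map_tofrac a : frac_map h_inj a%:F = (h a)%:F.
Proof.
by rewrite -[a%:F]divr1 -tofrac1 frac_mapE ?oner_neq0 // rmorph1 tofrac1 divr1.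
Qed.

Fact frac_map_monoid_morphism : monoid_morphism (frac_map h_inj).
Proof.
split=> [|x y]; first by rewrite -tofrac1 frac_map_tofrac rmorph1.
rewrite (fracE x) (fracE y).
have := denom_ratioP (repr x); have := denom_ratioP (repr y).
move: (\n_(repr x)) (\d_(repr x)) (\n_(repr y)) (\d_(repr y)) => a b c d d0 b0.
rewrite mulf_div -!tofracM !frac_mapE ?mulf_neq0 //.
by rewrite mulf_div -!tofracM !rmorphM.
Qed.
HB.instance Definition _ := GRing.isMonoidMorphism.Build
  {fraction A} {fraction B} (frac_map h_inj) frac_map_monoid_morphism.

Lemma poly_common_denom (p : {poly {fraction A}}) :
  exists d (P : {poly A}), d != 0 /\ d%:F *: p = map_poly (@FracField.tofrac A) P.
Proof.
elim/poly_ind: p => [|p c [d [P [d0 dP]]]].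
  by exists 1, 0; rewrite oner_neq0 scaler0 rmorph0.
rewrite (fracE c); have m0 := denom_ratioP (repr c).
move: (\n_(repr c)) (\d_(repr c)) m0 => n m m0.
exists (d * m), (m *: P * 'X + (d * n)%:P); split; first by rewrite mulf_neq0.
have E : d%:F * m%:F * (n%:F / m%:F) = d%:F * n%:F.
  by rewrite -mulrA [m%:F * _]mulrC divfK ?tofrac_eq0.
rewrite [in RHS]rmorphD [in RHS]rmorphM /= map_polyX map_polyC /= map_polyZ /= -dP.
by rewrite !tofracM scalerDr -[_ *: (_ / _)%:P]mul_polyC -polyCM E scalerA
  -scalerAl [m%:F * _]mulrC.
Qed.

(** Algebraicity with denominators cleared, so that equations can be manipulated inside [B] without
    passing to fractions. *)
Definition algOver (f : B) := exists2 P : {poly A}, P != 0 & (map_poly h P).[f] = 0.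

(** Clearing denominators loses nothing; the closure properties known over a field thereby descend
    to [B]. *)
Lemma algOver_frac f : algOver f <-> algebraicOver (frac_map h_inj) f%:F.
Proof.
have mapF (P : {poly A}) : map_poly (frac_map h_inj) (map_poly (@FracField.tofrac A) P)
   = map_poly (@FracField.tofrac B) (map_poly h P).
  by rewrite -!map_poly_comp; apply: eq_map_poly => a /=; rewrite frac_map_tofrac.
have tofrac_inj (D : idomainType) : injective (@FracField.tofrac D).
  by move=> x y /eqP; rewrite tofrac_eq => /eqP.
split=> [[P P0 Pf]|[p p0 pf]].
  exists (map_poly (@FracField.tofrac A) P).
    by rewrite map_poly_eq0_id0 ?tofrac_eq0 ?lead_coef_eq0.
  by rewrite /root mapF horner_map Pf rmorph0.
have [d [P [d0 dP]]] := poly_common_denom p; exists P.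
  apply: contraNneq p0 => P0; move: dP; rewrite P0 rmorph0 => /eqP.
  by rewrite scaler_eq0 tofrac_eq0 (negPf d0).
apply: (@tofrac_inj B); rewrite -horner_map -mapF -dP map_polyZ hornerZ.
by rewrite (rootP pf) mulr0 rmorph0.
Qed.

Lemma algOver_integral f : algOver f <-> integralOver (frac_map h_inj) f%:F.
Proof. by rewrite algOver_frac; exact: integral_algebraic. Qed.

Lemma algOver_id a : algOver (h a).
Proof. by rewrite algOver_frac -frac_map_tofrac; apply: algebraic_id. Qed.

Lemma algOver_add f g : algOver f -> algOver g -> algOver (f + g).
Proof. by rewrite !algOver_frac tofracD; apply: algebraic_add. Qed.

Lemma algOver_mul f g : algOver f -> algOver g -> algOver (f * g).
Proof. by rewrite !algOver_frac tofracM; apply: algebraic_mul. Qed.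

Lemma algOver_sum I (r : seq I) (P : pred I) (F : I -> B) :
  (forall i, P i -> algOver (F i)) -> algOver (\sum_(i <- r | P i) F i).
Proof.
by apply: big_ind; [rewrite -(rmorph0 h); apply: algOver_id | apply: algOver_add].
Qed.

Lemma algOver_prod I (r : seq I) (P : pred I) (F : I -> B) :
  (forall i, P i -> algOver (F i)) -> algOver (\prod_(i <- r | P i) F i).
Proof.
by apply: big_ind; [rewrite -(rmorph1 h); apply: algOver_id | apply: algOver_mul].
Qed.

Lemma algOver_exp f n : algOver f -> algOver (f ^+ n).
Proof.
move=> af; elim: n => [|n IHn]; first by rewrite expr0 -(rmorph1 h); apply: algOver_id.
by rewrite exprS; apply: algOver_mul.
Qed.

(** Replaces division: the quotient is taken in the fraction field, so [f] need not be a unit of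
    [B]. *)
Lemma algOver_cancel f g : f != 0 -> algOver f -> algOver (f * g) -> algOver g.
Proof.
move=> f0 /algOver_frac af /algOver_frac afg; apply/algOver_frac.
have := algebraic_div afg af; rewrite [f * g]mulrC tofracM mulfK //.
by rewrite tofrac_eq0.
Qed.

Lemma algOver_root f n : (0 < n)%N -> algOver (f ^+ n) -> algOver f.
Proof.
move=> n0 [P P0 Pf]; exists (P \Po 'X^n).
  by rewrite comp_poly_eq0 // size_polyXn ltnS.
by rewrite map_comp_poly /= map_polyXn horner_comp hornerXn.
Qed.

Lemma algOver_det n (M : 'M[B]_n) : (forall i j, algOver (M i j)) -> algOver (\det M).
Proof.
move=> aM; apply: algOver_sum => s _; apply: algOver_mul; last exact: algOver_prod.
by rewrite -(rmorph_sign h); apply: algOver_id.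
Qed.

Lemma algOver_adj n (M : 'M[B]_n) : (forall i j, algOver (M i j)) ->
  forall i j, algOver ((\adj M) i j).
Proof.
move=> aM i j; rewrite mxE; apply: algOver_mul.
  by rewrite -(rmorph_sign h); apply: algOver_id.
by apply: algOver_det => i' j'; rewrite !mxE.
Qed.

(** Cramer's rule through the adjugate. The determinant is cancelled rather than inverted, as [B] is
    only a domain. *)
Lemma algOver_mulmx_solve n (M : 'M[B]_n) (x : 'cV[B]_n) : \det M != 0 ->
  (forall i j, algOver (M i j)) -> (forall i, algOver ((M *m x) i 0)) ->
  forall i, algOver (x i 0).
Proof.
move=> d0 aM aMx i; apply: algOver_cancel d0 (algOver_det aM) _.
have -> : \det M * x i 0 = (\adj M *m (M *m x)) i 0.
  by rewrite mulmxA mul_adj_mx mul_scalar_mx mxE.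
by rewrite mxE; apply: algOver_sum => j _; apply: algOver_mul; [apply: algOver_adj|].
Qed.

End FracMap.

Lemma algOver_transport (A B D : idomainType) (h : {rmorphism A -> B})
    (g : {rmorphism B -> D}) f : injective g ->
  algOver (g \o h) (g f) <-> algOver h f.
Proof.
move=> g_inj; split=> -[P P0 Pf]; exists P => //; last first.
  by rewrite map_poly_comp horner_map Pf rmorph0.
by apply: g_inj; rewrite rmorph0 -Pf [in RHS]map_poly_comp horner_map.
Qed.

(* Over h', the coefficients of an equation over h are algebraic. *)
Lemma algOver_base_change (R B : idomainType) (h h' : {rmorphism {poly R} -> B}) f :
  injective h -> injective h' -> (forall c, h c%:P = h' c%:P) ->
  algOver h' (h 'X) -> algOver h f -> algOver h' f.
Proof.
move=> h_inj h'_inj hC hX [P P0 Pf]; apply/(algOver_integral h'_inj).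
(* As [h] and [h'] agree on constants, [h p] is a polynomial in [h 'X] with coefficients in the
   image of [h']. *)
have ah' p : algOver h' (h p).
  have -> : h p = \sum_(i < size p) h' (p`_i)%:P * h 'X ^+ i.
    rewrite -{1}[p]coefK poly_def rmorph_sum; apply: eq_bigr => i _.
    by rewrite -mul_polyC rmorphM hC rmorphXn.
  apply: algOver_sum => // i _; apply: algOver_mul => //; first exact: algOver_id.
  exact: algOver_exp.
have hP0 : map_poly h P != 0.
  by rewrite map_poly_eq0_id0 ?inj_rmorph_eq0 ?lead_coef_eq0.
(* Transitivity: a root of a nonzero polynomial with algebraic coefficients is algebraic. *)
apply: (@integral_root _ _ _ (map_poly (@FracField.tofrac B) (map_poly h P))).
- by rewrite map_poly_eq0_id0 ?tofrac_eq0 ?lead_coef_eq0.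
- by rewrite /root horner_map Pf rmorph0.
by apply/integral_poly => i; rewrite !coef_map; apply/algOver_integral/ah'.
Qed.

(** * Composition of power series *)

Local Notation fpsX := (fps_of_poly 'X).
Local Notation fpsC c := (fps_of_poly c%:P).

Section FpsSubst.
Variable R : idomainType.
Implicit Types (f g u : fps R) (p q : {poly R}) (c : R).

Lemma fps_of_poly_inj : injective (@fps_of_poly R).
Proof. by move=> p q /fpsP E; apply/polyP => i; apply: E. Qed.

Definition fps_coef0 f : R := f 0%N.
#[global] Arguments fps_coef0 : simpl never.

Fact fps_coef0_zmod_morphism : zmod_morphism fps_coef0.
Proof. by []. Qed.
HB.instance Definition _ := GRing.isZmodMorphism.Build (fps R) R
  fps_coef0 fps_coef0_zmod_morphism.
Fact fps_coef0_monoid_morphism : monoid_morphism fps_coef0.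
Proof.
by split=> [|f g]; rewrite /fps_coef0 /= ?coef1 // big_ord1.
Qed.
HB.instance Definition _ := GRing.isMonoidMorphism.Build (fps R) R
  fps_coef0 fps_coef0_monoid_morphism.

Lemma fps_coef0X : fps_coef0 fpsX = 0.
Proof. exact: coefX. Qed.

Lemma coef_fpsCM c f n : (fpsC c * f) n = c * f n.
Proof.
rewrite coef_fpsM big_ord_recl big1 ?addr0 ?subn0 /= ?coefC // => i _.
by rewrite coefC mul0r.
Qed.

Lemma coef_fpsXnM i f n : (fpsX ^+ i * f) n = if (n < i)%N then 0 else f (n - i)%N.
Proof.
rewrite -rmorphXn [LHS](@fps_mul_coefM _ _ _ 'X^i (fps_trunc n f)) => [|//|j jn].
  by rewrite coefXnM coef_fps_trunc ?leq_subr.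
by rewrite coef_fps_trunc.
Qed.

Lemma coef_fps_sum I (r : seq I) (P : pred I) (F : I -> fps R) n :
  (\sum_(i <- r | P i) F i) n = \sum_(i <- r | P i) F i n.
Proof. by elim/big_rec2: _ => [|i _ f _ <-] //; rewrite coef_fps0. Qed.

Lemma fps_divXn n f : (forall i, (i < n)%N -> f i = 0) ->
  f = fpsX ^+ n * Fps (fun i => f (i + n)%N).
Proof.
move=> f0; apply/fpsP => i; rewrite coef_fpsXnM /=.
by case: ltnP => [/f0|/subnK->].
Qed.

Lemma fps_divX f : fps_coef0 f = 0 -> exists g, f = fpsX * g.
Proof.
move=> f0; exists (Fps (fun i => f (i + 1)%N)); rewrite -(expr1 fpsX) -fps_divXn //.
by case.
Qed.

Definition polyfps_subst u p : fps R :=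
  (map_poly (@fps_of_poly R \o polyC) p).[fpsX * u].

Fact polyfps_subst_zmod_morphism u : zmod_morphism (polyfps_subst u).
Proof. by move=> p q; rewrite /polyfps_subst rmorphB hornerD hornerN. Qed.
HB.instance Definition _ u := GRing.isZmodMorphism.Build {poly R} (fps R)
  (polyfps_subst u) (polyfps_subst_zmod_morphism u).
Fact polyfps_subst_monoid_morphism u : monoid_morphism (polyfps_subst u).
Proof.
by split=> [|p q]; rewrite /polyfps_subst ?rmorph1 ?hornerC // rmorphM hornerM.
Qed.
HB.instance Definition _ u := GRing.isMonoidMorphism.Build {poly R} (fps R)
  (polyfps_subst u) (polyfps_subst_monoid_morphism u).

Lemma polyfps_substX u : polyfps_subst u 'X = fpsX * u.
Proof. by rewrite /polyfps_subst map_polyX hornerX. Qed.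

Lemma polyfps_substC u c : polyfps_subst u c%:P = fpsC c.
Proof. by rewrite /polyfps_subst map_polyC hornerC. Qed.

Lemma polyfps_substZXn u c n : polyfps_subst u (c *: 'X^n) = fpsC c * (fpsX * u) ^+ n.
Proof. by rewrite -mul_polyC rmorphM rmorphXn /= polyfps_substX polyfps_substC. Qed.

(** The difference [p - q] is divisible by ['X^n.+1], hence its image by [fpsX ^+ n.+1]. This is
    what lets the composition extend from polynomials to series through truncations. *)
Lemma coef_polyfps_subst_eq u p q n : (forall i, (i <= n)%N -> p`_i = q`_i) ->
  polyfps_subst u p n = polyfps_subst u q n.
Proof.
move=> pq; apply/eqP; rewrite -subr_eq0.
have -> : polyfps_subst u p n - polyfps_subst u q n = polyfps_subst u (p - q) n.
  by rewrite rmorphB.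
have -> : p - q = 'X^(n.+1) * drop_poly n.+1 (p - q).
  rewrite -{1}[p - q](poly_take_drop n.+1) mulrC [take_poly _ _](_ : _ = 0) ?add0r //.
  apply/polyP => i; rewrite coef_take_poly coef0 ltnS; case: ifP => // /pq E.
  by rewrite coefB E subrr.
set r := drop_poly _ _.
have -> : polyfps_subst u ('X^(n.+1) * r) =
    fpsX ^+ n.+1 * (u ^+ n.+1 * polyfps_subst u r).
  by rewrite rmorphM rmorphXn /= polyfps_substX exprMn mulrA.
by rewrite coef_fpsXnM ltnSn.
Qed.

(* The composition f(t u(t)); every series without constant term is of the form
   t u(t). *)
Definition fps_subst u f : fps R := Fps (fun n => polyfps_subst u (fps_trunc n f) n).

Lemma coef_fps_subst u f p n : (forall i, (i <= n)%N -> f i = p`_i) ->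
  fps_subst u f n = polyfps_subst u p n.
Proof.
by move=> fp; apply: coef_polyfps_subst_eq => i le_in; rewrite coef_fps_trunc ?fp.
Qed.

Lemma coef_fps_substE u f n :
  fps_subst u f n = \sum_(i < n.+1) f i * ((fpsX * u) ^+ i) n.
Proof.
have E : polyfps_subst u (fps_trunc n f) =
    \sum_(i < n.+1) fpsC (f i) * (fpsX * u) ^+ i.
  rewrite /fps_trunc poly_def rmorph_sum /=.
  by apply: eq_bigr => i _; rewrite polyfps_substZXn.
transitivity (polyfps_subst u (fps_trunc n f) n); first by [].
rewrite E coef_fps_sum.
by apply: eq_bigr => i _; rewrite coef_fpsCM.
Qed.

Lemma fps_subst_of_poly u p : fps_subst u (fps_of_poly p) = polyfps_subst u p.
Proof. by apply/fpsP => n; apply: coef_fps_subst. Qed.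

Fact fps_subst_zmod_morphism u : zmod_morphism (fps_subst u).
Proof.
move=> f g; apply/fpsP => n.
rewrite (@coef_fps_subst _ _ (fps_trunc n f - fps_trunc n g)) ?rmorphB //.
by move=> i le_in; rewrite coefB !coef_fps_trunc.
Qed.
HB.instance Definition _ u := GRing.isZmodMorphism.Build (fps R) (fps R)
  (fps_subst u) (fps_subst_zmod_morphism u).
Fact fps_subst_monoid_morphism u : monoid_morphism (fps_subst u).
Proof.
split=> [|f g]; first by rewrite -(rmorph1 (@fps_of_poly R)) fps_subst_of_poly !rmorph1.
apply/fpsP => n; rewrite (@coef_fps_subst _ _ (fps_trunc n f * fps_trunc n g)).
  rewrite rmorphM !coef_fpsM; apply: eq_bigr => i _.
  congr (_ * _); symmetry; apply: coef_fps_subst => j le_j.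
    by rewrite coef_fps_trunc // (leq_trans le_j) // -ltnS.
  by rewrite coef_fps_trunc // (leq_trans le_j) // leq_subr.
by move=> i; apply: fps_mul_trunc.
Qed.
HB.instance Definition _ u := GRing.isMonoidMorphism.Build (fps R) (fps R)
  (fps_subst u) (fps_subst_monoid_morphism u).

Lemma fps_substX u : fps_subst u fpsX = fpsX * u.
Proof. by rewrite fps_subst_of_poly polyfps_substX. Qed.

Lemma fps_substC u c : fps_subst u (fpsC c) = fpsC c.
Proof. by rewrite fps_subst_of_poly polyfps_substC. Qed.

Lemma fps_subst_coef0 u f : fps_coef0 (fps_subst u f) = fps_coef0 f.
Proof. by rewrite /fps_coef0 coef_fps_substE big_ord1 expr0 /= coef1 mulr1. Qed.

Lemma fps_subst_scale c f n : fps_subst (fpsC c) f n = c ^+ n * f n.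
Proof.
have E (i : nat) : ((fpsX * fpsC c) ^+ i) n = c ^+ i * (n == i)%:R.
  have -> : (fpsX * fpsC c) ^+ i = fps_of_poly (c ^+ i *: 'X^i).
    by rewrite -rmorphM -rmorphXn exprMn mulrC -polyC_exp mul_polyC.
  by rewrite /= coefZ coefXn.
rewrite coef_fps_substE (bigD1 ord_max) //= E eqxx mulr1 mulrC big1 ?addr0 // => i.
by rewrite -val_eqE /= eq_sym E => /negPf->; rewrite !mulr0.
Qed.

(** The exponent is [k.-1] because substitution supplies one more factor t: the series is f(t^k). *)
Lemma fps_subst_Xn k f n : (0 < k)%N ->
  fps_subst (fpsX ^+ k.-1) f n = if (k %| n)%N then f (n %/ k)%N else 0.
Proof.
move=> k0; rewrite coef_fps_substE -exprS prednK //.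
under eq_bigr => i _ do rewrite -exprM -rmorphXn /= coefXn mulr_natr mulrb.
case: ifP => [/dvdnP[q]|kn]; last first.
  by rewrite big1 // => i _; case: eqP => // E; rewrite E dvdn_mulr in kn.
rewrite mulnC => ->; rewrite mulKn //.
have lt_q : (q < (k * q).+1)%N by rewrite ltnS leq_pmull.
rewrite (bigD1 (Ordinal lt_q)) //= eqxx big1 ?addr0 // => i.
by rewrite eqn_pmul2l // -val_eqE eq_sym => /negPf->.
Qed.

(** If f = t^n g with g(0) nonzero, the image of f is (t u)^n times a series with the same constant
    term as g, and both factors are nonzero. *)
Lemma fps_subst_inj u : u != 0 -> injective (fps_subst u).
Proof.
move=> u0; suff s0 f : fps_subst u f = 0 -> f = 0 by apply: raddf_inj.
apply: contra_eq => /fps_neq0_order[n [fn fi]].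
have X0 : fpsX != 0 :> fps R by rewrite fps_of_poly_eq0 polyX_eq0.
rewrite (fps_divXn fi) rmorphM rmorphXn /= fps_substX.
rewrite mulf_neq0 ?expf_neq0 ?mulf_neq0 //.
apply: contraNneq fn => E.
have := congr1 fps_coef0 E; rewrite fps_subst_coef0 rmorph0.
by rewrite /fps_coef0 /= add0n => ->.
Qed.

End FpsSubst.

(** * Inversion of the composition, and roots of series *)

Lemma fps_subst_surj (F : fieldType) (u g : fps F) : fps_coef0 u != 0 ->
  exists f, fps_subst u f = g.
Proof.
move=> u0.
(* The system for the coefficients is triangular: [approx m] solves it below degree m, and (t u)^m
   starts with u(0)^m t^m, so the new coefficient corrects the error in degree m and disturbs
   nothing lower. *)
pose fix approx n : {poly F} := if n is m.+1
  then approx m + ((g m - polyfps_subst u (approx m) m) / u 0%N ^+ m) *: 'X^m else 0.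
have approxE m i : (i < m)%N -> (approx m)`_i = (approx i.+1)`_i.
  elim: m => // m IHm; rewrite ltnS leq_eqVlt => /predU1P[-> //|lt_im].
  by rewrite [approx m.+1]/= coefD coefZ coefXn ltn_eqF // mulr0 addr0 IHm.
exists (Fps (fun n => (approx n.+1)`_n)); apply/fpsP => n.
rewrite (@coef_fps_subst _ _ _ (approx n.+1)) => [|i le_in]; last first.
  by rewrite (approxE n.+1) ?ltnS.
rewrite [approx n.+1]/= rmorphD coef_fpsD [X in _ + fps_coef X _]polyfps_substZXn.
rewrite coef_fpsCM exprMn coef_fpsXnM ltnn subnn.
have -> : (u ^+ n) 0%N = u 0%N ^+ n := rmorphXn (@fps_coef0 F) n u.
by rewrite divfK ?expf_neq0 // addrC subrK.
Qed.

(* With e(t) = (1 + t)^n - 1 and tau its inverse for composition, the root is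
   1 + tau(f - 1). *)
Lemma fps_root_exists (F : fieldType) (n : nat) (f : fps F) : n%:R != 0 :> F ->
  fps_coef0 f = 1 -> exists2 g, fps_coef0 g = 1 & g ^+ n = f.
Proof.
move=> n0 f1; pose w : fps F := \sum_(i < n) (1 + fpsX) ^+ i.
have w0 : fps_coef0 w = n%:R.
  rewrite rmorph_sum -[in RHS](card_ord n) -sumr_const; apply: eq_bigr => i _.
  by rewrite rmorphXn rmorphD rmorph1 /= fps_coef0X addr0 expr1n.
have wE : 1 + fpsX * w = (1 + fpsX) ^+ n.
  have := subrX1 (1 + fpsX : fps F) n.
  by rewrite [1 + fpsX - 1]addrC addKr => <-; rewrite addrC subrK.
have w_unit : fps_coef0 w != 0 by rewrite w0.
have w_neq0 : w != 0 by apply: contraNneq w_unit => ->; rewrite rmorph0.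
have [tau tauE] := fps_subst_surj fpsX w_unit.
have tau_root : (1 + tau) ^+ n = 1 + fpsX.
  apply: (fps_subst_inj w_neq0).
  by rewrite rmorphXn !rmorphD !rmorph1 /= tauE fps_substX wE.
have [|v vE] := @fps_divX _ (f - 1); first by rewrite rmorphB rmorph1 /= f1 subrr.
exists (fps_subst v (1 + tau)).
  by rewrite fps_subst_coef0 -(fps_subst_coef0 w) rmorphD rmorph1 /= tauE
    rmorphD rmorph1 /= fps_coef0X addr0.
by rewrite -rmorphXn tau_root rmorphD rmorph1 /= fps_substX -vE addrC subrK.
Qed.

(** * Composition and algebraicity *)

Local Notation fps_alg := (algOver (@fps_of_poly _)).

Section FpsAlgebraic.
Variable R : idomainType.
Implicit Types (f g u : fps R).

Lemma fps_algebraicE f : fps_algebraic f <-> fps_alg f.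
Proof. exact: iff_sym (algOver_frac (@fps_of_poly_inj R) f). Qed.

Lemma fps_alg_X : algOver (@fps_of_poly R) fpsX. Proof. exact: algOver_id (@fps_of_poly_inj R) _. Qed.

(* Exchanging the variables in P(t, t u) = 0 makes t algebraic over C(t u). *)
Lemma fps_alg_exchange u : fps_alg (fpsX * u) ->
  algOver (fps_subst u \o @fps_of_poly R) fpsX.
Proof.
case=> P P0 PZ; exists (swapXY P); first by rewrite swapXY_eq0.
pose const : {rmorphism R -> fps R} := @fps_of_poly R \o polyC.
have constE p : fps_of_poly p = (map_poly const p).[fpsX].
  elim/poly_ind: p => [|p c IHp]; first by rewrite !rmorph0 horner0.
  by rewrite !rmorphD !rmorphM /= map_polyX map_polyC hornerMXaddC -IHp.
(* Both equations become values of one bivariate polynomial: [Y] goes into the outer variable, [W]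
   into the variable of the coefficients. *)
have evalE (h : {poly R} -> fps R) W Y Q : (forall p, h p = (map_poly const p).[W]) ->
    (map_poly h Q).[Y] = (map_poly (map_poly const) Q).[Y, W].
  move=> hE; rewrite -horner2_swapXY horner_swapXY -map_poly_comp.
  by congr (_.[Y]); apply: eq_map_poly => p; rewrite hE.
rewrite -PZ [RHS](evalE _ fpsX) // (evalE _ (fpsX * u)) => [|p].
  by rewrite -(swapXY_map const) horner2_swapXY.
by rewrite /= fps_subst_of_poly.
Qed.

(** As t is algebraic over C(t u), f(t u) is algebraic over C(t u) too; the injective substitution
    then reflects its equation to one for f over C(t). *)
Lemma fps_alg_of_subst u f : u != 0 ->
  fps_alg (fpsX * u) -> fps_alg (fps_subst u f) -> fps_alg f.
Proof.
move=> u0 aXu af; have s_inj := fps_subst_inj u0.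
apply/(algOver_transport (@fps_of_poly R) f s_inj).
apply: (@algOver_base_change _ _ (@fps_of_poly R)) af.
- exact: fps_of_poly_inj.
- exact: inj_comp s_inj (@fps_of_poly_inj R).
- by move=> c; rewrite /= fps_substC.
exact: fps_alg_exchange.
Qed.

(** Substituting in the equation of f makes f(t u) algebraic over C(t u), and t u is itself
    algebraic over C(t). *)
Lemma fps_alg_subst u f : u != 0 ->
  fps_alg (fpsX * u) -> fps_alg f -> fps_alg (fps_subst u f).
Proof.
move=> u0 aXu af; have s_inj := fps_subst_inj u0.
apply: (@algOver_base_change _ _ (fps_subst u \o @fps_of_poly R)).
- exact: inj_comp s_inj (@fps_of_poly_inj R).
- exact: fps_of_poly_inj.
- by move=> c; rewrite /= fps_substC.
- by rewrite /= fps_substX.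
exact/(algOver_transport (@fps_of_poly R) f s_inj).
Qed.

End FpsAlgebraic.

(** * Sections and the Appell relation *)

(** Since n is nonzero in [F], X^n - 1 is separable; its n distinct roots force a primitive one. *)
Lemma closed_prim_root_exists (F : closedFieldType) n : n%:R != 0 :> F ->
  exists z : F, n.-primitive_root z.
Proof.
move=> nF; have n0 : (0 < n)%N by case: n nF => //; rewrite eqxx.
have [r Dp] := closed_field_poly_normal ('X^n - 1 : {poly F}).
rewrite (monicP _) ?monicXnsubC // scale1r in Dp.
have rn1 : all n.-unity_root r by apply/allP => z; rewrite -root_prod_XsubC -Dp.
have sz_r : (n < (size r).+1)%N by rewrite -(size_prod_XsubC r id) -Dp size_XnsubC.
have [|z] := hasP (has_prim_root n0 rn1 _ sz_r); last by exists z.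
by rewrite -separable_prod_XsubC -Dp separable_Xn_sub_1.
Qed.

Definition fps_section (R : Type) (k : nat) (a : nat -> R) (j : nat) : fps R :=
  Fps (fun q => a (q * k + j)%N).

Section Appell.
Variables (F : fieldType) (k l : nat) (b s : nat -> nat) (a : nat -> F).
Hypothesis k0 : (0 < k)%N.
Hypothesis sE : forall q j, (j < k)%N -> s (q * k + j) = (q * l + b j)%N.

Lemma fps_sections_sum :
  Fps a = \sum_(j < k) fpsX ^+ j * fps_subst (fpsX ^+ k.-1) (fps_section k a j).
Proof.
apply/fpsP => n; rewrite coef_fps_sum.
rewrite (bigD1 (Ordinal (ltn_pmod n k0))) // big1 => [|j].
  rewrite Monoid.mulm1 coef_fpsXnM fps_subst_Xn //=.
  have nE : (n - n %% k = n %/ k * k)%N by rewrite {1}(divn_eq n k) addnK.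
  by rewrite ltnNge leq_mod /= nE dvdn_mull // mulnK // -divn_eq.
rewrite -val_eqE coef_fpsXnM fps_subst_Xn //= => jn.
case: ltnP => // le_jn; case: ifP => // kn.
have := eqn_mod_dvd k le_jn; rewrite kn => /eqP nj.
by rewrite nj modn_small ?eqxx in jn.
Qed.

(** For n = qk + j, the factor t^n phi^(s_n) is t^j phi^(b_j) (t chi)^(qk); summing over q first
    gives the sections at (t chi)^k. *)
Lemma appell_sections (phi chi Psi : fps F) : chi ^+ k = phi ^+ l ->
  fps_sum_to (fun n => fps_of_poly (a n *: 'X^n) * phi ^+ s n) Psi ->
  \sum_(j < k) fpsX ^+ j * phi ^+ b j *
    fps_subst chi (fps_subst (fpsX ^+ k.-1) (fps_section k a j)) = Psi.
Proof.
move=> chiE appell; apply/fpsP => m; have [N0 N0P] := appell m.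
(* Enough full blocks of length k to pass [N0], and more than m of them, so that cutting each
   section at [Q] terms leaves the coefficients up to degree m intact. *)
pose Q := (maxn N0 m).+1.
have le_N0 : (N0 <= Q * k)%N.
  by rewrite (leq_trans _ (leq_pmulr _ k0)) // /Q leqW // leq_maxl.
rewrite -(N0P _ le_N0).
pose p j : {poly F} := (\poly_(q < Q) a (q * k + j)%N) \Po 'X^k.
have pE j : polyfps_subst chi (p j) =
    \sum_(q < Q) fpsC (a (q * k + j)%N) * (fpsX ^+ (q * k) * phi ^+ (q * l)).
  rewrite /p poly_def rmorph_sum rmorph_sum; apply: eq_bigr => q _ /=.
  rewrite comp_polyZ comp_Xn_poly -exprM polyfps_substZXn exprMn; congr (_ * (_ * _)).
    by rewrite mulnC.
  by rewrite exprM chiE -exprM mulnC.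
have -> : \sum_(n < Q * k) fps_of_poly (a n *: 'X^n) * phi ^+ s n =
    \sum_(j < k) fpsX ^+ j * phi ^+ b j * polyfps_subst chi (p j).
  rewrite -(big_mkord xpredT (fun n => fps_of_poly (a n *: 'X^n) * phi ^+ s n)).
  rewrite big_nat_mul big_mkord.
  under eq_bigr => q _ do rewrite mulSn -{1}[(q * k)%N]add0n big_addn addnK big_mkord.
  rewrite exchange_big; apply: eq_bigr => j _ /=.
  rewrite pE mulr_sumr; apply: eq_bigr => q _.
  rewrite addnC sE // -mul_polyC rmorphM rmorphXn /= !exprD; ring.
rewrite !coef_fps_sum; apply: eq_bigr => j _; rewrite !coef_fpsM.
apply: eq_bigr => i _; congr (_ * _); apply: coef_fps_subst => n le_n.
rewrite fps_subst_Xn // /p coef_comp_poly_Xn //; case: ifP => // _.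
rewrite coef_poly /Q ltnS (leq_trans (leq_div _ _)) //.
by rewrite (leq_trans le_n) // (leq_trans (leq_subr _ _)) ?leq_maxr.
Qed.

End Appell.

(** * The linear system given by the roots of unity *)

Theorem appell_sections_algebraic (F : closedFieldType) (k l : nat) (b s : nat -> nat)
    (a : nat -> F) (phi Psi : fps F) :
  k%:R != 0 :> F ->
  (forall q j, (j < k)%N -> s (q * k + j)%N = (q * l + b j)%N) ->
  fps_alg phi -> fps_alg Psi -> fps_coef0 phi = 1 ->
  fps_sum_to (fun n => fps_of_poly (a n *: 'X^n) * phi ^+ s n) Psi ->
  fps_alg (Fps a) /\ forall j, (j < k)%N -> fps_alg (fps_section k a j).
Proof.
move=> kF sE aphi aPsi phi0 appell.
have k0 : (0 < k)%N by case: k kF {sE} => //; rewrite eqxx.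
have poly_inj := @fps_of_poly_inj F; have aX := fps_alg_X F.
have X0 : fpsX != 0 :> fps F by rewrite fps_of_poly_eq0 polyX_eq0.
have neq0_of_coef0 (f : fps F) : fps_coef0 f != 0 -> f != 0.
  by apply: contraNneq => ->; rewrite rmorph0.
(* [chi] is phi^(l/k), so Z is [fpsX * chi]. *)
have [|chi chi0 chiE] := @fps_root_exists _ k (phi ^+ l) kF.
  by rewrite rmorphXn /= phi0 expr1n.
have chi_unit : fps_coef0 chi != 0 by rewrite chi0 oner_eq0.
have chi_neq0 := neq0_of_coef0 _ chi_unit.
have aXchi : fps_alg (fpsX * chi).
  apply: algOver_mul => //; apply: (algOver_root k0); rewrite chiE.
  exact: algOver_exp.
(* [tau], [phi'] and [psi'] are t, phi and Psi rewritten as series in Z. *)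
have [tau tauE] := fps_subst_surj fpsX chi_unit.
have [phi' phi'E] := fps_subst_surj phi chi_unit.
have [psi' psi'E] := fps_subst_surj Psi chi_unit.
have [|ups upsE] := @fps_divX _ tau.
  by rewrite -(fps_subst_coef0 chi) tauE fps_coef0X.
have ups0 : fps_coef0 ups = 1.
  (* Put Z into [tau] = t [ups]: this reads t = t chi ups(Z), and t cancels. *)
  have : chi * fps_subst chi ups = 1.
    apply: (mulfI X0); rewrite mulr1 -[RHS]tauE upsE rmorphM /= fps_substX mulrA //.
  move/(congr1 (@fps_coef0 F)); rewrite rmorphM rmorph1 /= fps_subst_coef0 chi0.
  by rewrite mul1r.
have a_of f : fps_alg (fps_subst chi f) -> fps_alg f by apply: fps_alg_of_subst.
have atau : fps_alg tau by apply: a_of; rewrite tauE.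
have aups : fps_alg ups by apply: (algOver_cancel poly_inj X0); rewrite -?upsE.
have phi'0 : fps_coef0 phi' = 1 by rewrite -(fps_subst_coef0 chi) phi'E.
have aphi' : fps_alg phi' by apply: a_of; rewrite phi'E.
have apsi' : fps_alg psi' by apply: a_of; rewrite psi'E.
pose B (j : nat) := fps_subst (fpsX ^+ k.-1) (fps_section k a j).
have tau_eq : \sum_(j < k) tau ^+ j * phi' ^+ b j * B j = psi'.
  apply: (fps_subst_inj chi_neq0); rewrite psi'E -(appell_sections k0 sE chiE appell).
  rewrite rmorph_sum; apply: eq_bigr => j _.
  by rewrite !rmorphM !rmorphXn /= tauE phi'E.
have [w w_prim] := closed_prim_root_exists kF.
have w0 : w != 0.
  apply: contra_eq_neq (prim_expr_order w_prim) => ->.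
  by rewrite expr0n gtn_eqF // eq_sym oner_eq0.
pose rot (i : nat) := fps_subst (fpsC (w ^+ i)).
(* [B j] is a series in t^k, and (w^i)^k = 1. *)
have rotB i j : rot i (B j) = B j.
  apply/fpsP => n; rewrite fps_subst_scale fps_subst_Xn //.
  case: ifP => [/dvdnP[q ->]|_]; last by rewrite mulr0.
  by rewrite -exprM mulnA mulnC exprM (prim_expr_order w_prim) expr1n mul1r.
have a_rot i f : fps_alg f -> fps_alg (rot i f).
  apply: fps_alg_subst; first by rewrite fps_of_poly_eq0 polyC_eq0 expf_neq0.
  by apply: algOver_mul => //; apply: algOver_id.
(* From tau^j = t^j ups^j, the power t^j is moved into the unknown; left in the matrix, it would
   make the constant term of the determinant vanish for k > 1. *)
pose M := \matrix_(i < k, j < k)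
  (fpsC (w ^+ i) ^+ j * rot i ups ^+ j * rot i phi' ^+ b j).
pose x := \col_(j < k) (fpsX ^+ j * B j).
have aM i j : fps_alg (M i j).
  rewrite mxE; do 2?[apply: algOver_mul => //]; apply: algOver_exp => //; try exact: a_rot.
  exact: algOver_id.
have Mx i : (M *m x) i 0 = rot i psi'.
  have rotM f g : rot i (f * g) = rot i f * rot i g := rmorphM _ f g.
  have rotXn f n : rot i (f ^+ n) = rot i f ^+ n := rmorphXn _ n f.
  rewrite mxE -tau_eq [RHS]rmorph_sum; apply: eq_bigr => j _.
  rewrite !mxE [RHS]rotM rotB rotM !rotXn upsE rotM [rot i fpsX]fps_substX !exprMn.
  ring.
have detM : \det M != 0.
  apply: neq0_of_coef0; rewrite -det_map_mx.
  (* [ups] and [phi'] have constant term 1, so only the powers of w survive. *)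
  have -> : map_mx (@fps_coef0 F) M = (Vandermonde k (\row_i w ^+ i))^T.
    apply/matrixP => i j; rewrite !mxE !rmorphM !rmorphXn /=.
    rewrite !fps_subst_coef0 ups0 phi'0 !expr1n !mulr1.
    by rewrite [fps_coef0 _]coefC.
  rewrite det_tr det_Vandermonde; apply/prodf_neq0 => i _; apply/prodf_neq0 => j ij.
  rewrite !mxE subr_eq0 (eq_prim_root_expr w_prim) !modn_small //.
  by rewrite gtn_eqF.
have ax (j : nat) : (j < k)%N -> fps_alg (fpsX ^+ j * B j).
  move=> jk; have := algOver_mulmx_solve poly_inj detM aM.
  move=> /(_ x) ax; have := ax _ (Ordinal jk); rewrite mxE; apply => i.
  by rewrite Mx; apply: a_rot.
split=> [|j jk].
  (* The full generating function is the sum of the unknowns. *)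
  by rewrite (fps_sections_sum _ k0); apply: algOver_sum => // j _; apply: ax.
have aB := algOver_cancel poly_inj (expf_neq0 j X0) (algOver_exp poly_inj j aX) (ax j jk).
apply: fps_alg_of_subst aB; first exact: expf_neq0.
by apply: algOver_mul => //; apply: algOver_exp.
Qed.

Theorem theorem4p2 (R : realType) (k : nat) (hk : (1 <= k)%N)
  (b : k.-tuple nat) (l : nat) (hl : l = nth 0%N b (k - 1))
  (s : nat -> nat)
  (hs : forall q j : nat, (j <= k - 1)%N -> s (q * k + j)%N = (q * l + nth 0%N b j)%N)
  (ell : nat -> R[i]) (phi Psi : fps R[i])
  (phi_alg : fps_algebraic phi) (Psi_alg : fps_algebraic Psi) (phi0 : phi 0%N = 1)
  (appell : fps_sum_to (fun n => fps_of_poly (ell n *: 'X^n) * phi ^+ s n) Psi) :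
  fps_algebraic (Fps ell) /\
  forall j : nat, (j <= k - 1)%N ->
    fps_algebraic (Fps (fun q : nat => ell (q * k + j)%N)).
Proof.
have lt_k j : (j < k)%N = (j <= k - 1)%N by rewrite subn1 -[RHS]ltnS prednK.
(* Characteristic zero: the roots of unity and the k-th root of phi^l are available for every k >=
   1. *)
have kC : k%:R != 0 :> R[i] by rewrite Num.Theory.pnatr_eq0 -lt0n.
have sE q j : (j < k)%N -> s (q * k + j)%N = (q * l + nth 0%N b j)%N.
  by rewrite lt_k => /hs.
have /fps_algebraicE aphi := phi_alg; have /fps_algebraicE aPsi := Psi_alg.
have [aell asec] := appell_sections_algebraic kC sE aphi aPsi phi0 appell.
split=> [|j]; first exact/fps_algebraicE.
by rewrite -lt_k => jk; apply/fps_algebraicE/asec.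
Qed.
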